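(* Let $N_1,\dots,N_6$ be positive integers with $\prod_{h=1}^6N_h>1$, and put $\Sigma=\sum_{h=1}^6N_h$, $\Pi=\prod_{h=1}^6N_h$, $\Gamma_0=N_1N_3N_5+N_2N_4N_6$, $$\Gamma_1=N_1N_3+N_1N_4+N_1N_5+N_2N_4+N_2N_5+N_2N_6+N_3N_5+N_3N_6+N_4N_6,$$ $$p=\tfrac13(3\Gamma_1-\Sigma^2),\qquad q=\tfrac1{27}\bigl(-2\Sigma^3+9\Sigma\Gamma_1-27\Pi-27\Gamma_0-27\bigr),\qquad \Delta=q^2+\tfrac4{27}p^3.$$ Let $A=(A_{h,h'})_{1\le h,h'\le 6}$ be the matrix with $A_{h,h+1}=N_h$, $A_{h+1,h}=1$ for $1\le h\le5$, $A_{6,1}=N_6$, $A_{1,6}=1$, and all other entries $0$. If $\Delta<0$, then the Perron eigenvalue of $A$ is $$\lambda(A)=\sqrt{\tfrac13\Sigma+2\sqrt{-\tfrac13p}\,\cos\bigl(\tfrac13\Phi\bigr)},\qquad \Phi=\arccos\left(\frac{3q}{2p}\sqrt{-\frac{3}{p}}\right).$$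
   Context: The Perron eigenvalue of a non-negative irreducible square matrix is its spectral radius, which is an eigenvalue. *)

(* Defs.v *)
From HB Require Import structures.
From mathcomp Require Export all_boot all_order all_algebra.
From mathcomp Require Export all_classical all_reals all_analysis.
From mathcomp Require Export complex.

Set Implicit Arguments.
Unset Strict Implicit.
Unset Printing Implicit Defensive.
Import Order.TTheory GRing.Theory Num.Theory.
Local Open Scope classical_set_scope.
Local Open Scope ring_scope.

Definition nonnegative_mx (R : realType) (n : nat) (A : 'M[R]_n) : Prop :=
  forall i j, 0 <= A i j.

(* Strong connectedness of the digraph with an arc from i to j when
   A i j != 0. *)
Definition irreducible_mx (R : realType) (n : nat) (A : 'M[R]_n) : Prop :=
  forall i j, connect (fun k l => A k l != 0) i j.

(* The eigenvalues of the real matrix A are taken in R[i]. *)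
Definition spectral_radius (R : realType) (n : nat) (A : 'M[R]_n) : R :=
  sup [set ComplexField.Normc.normc z
      | z in [set z : R[i] | eigenvalue (map_mx (real_complex R) A) z]].

Definition is_perron_eigenvalue (R : realType) (n : nat) (A : 'M[R]_n)
    (lam : R) : Prop :=
  [/\ nonnegative_mx A, irreducible_mx A,
      lam = spectral_radius A & eigenvalue A lam].

(* The parameters N_1, ..., N_6 are the values at 1, ..., 6 of N : nat -> nat;
   the other values of N are never used. *)

Definition Sigma (N : nat -> nat) : nat := (\sum_(1 <= h < 7) N h)%N.

Definition Pi (N : nat -> nat) : nat := (\prod_(1 <= h < 7) N h)%N.

Definition Gamma0 (N : nat -> nat) : nat :=
  (N 1 * N 3 * N 5 + N 2 * N 4 * N 6)%N.

Definition Gamma1 (N : nat -> nat) : nat :=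
  (N 1 * N 3 + N 1 * N 4 + N 1 * N 5 + N 2 * N 4 + N 2 * N 5 + N 2 * N 6
   + N 3 * N 5 + N 3 * N 6 + N 4 * N 6)%N.

Definition coef_p (R : realType) (N : nat -> nat) : R :=
  1 / 3 * (3 * (Gamma1 N)%:R - (Sigma N)%:R ^+ 2).

Definition coef_q (R : realType) (N : nat -> nat) : R :=
  1 / 27 * (- 2 * (Sigma N)%:R ^+ 3 + 9 * (Sigma N)%:R * (Gamma1 N)%:R
            - 27 * (Pi N)%:R - 27 * (Gamma0 N)%:R - 27).

Definition Delta (R : realType) (N : nat -> nat) : R :=
  coef_q R N ^+ 2 + 4 / 27 * coef_p R N ^+ 3.

Definition Phi (R : realType) (N : nat -> nat) : R :=
  acos (3 * coef_q R N / (2 * coef_p R N) * Num.sqrt (- (3 / coef_p R N))).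

(* The entry A_{h,h'} with 1 <= h, h' <= 6 sits at the 0-based position
   (h.-1, h'.-1). *)
Definition cyc_mx (R : realType) (N : nat -> nat) : 'M[R]_6 :=
  \matrix_(i < 6, j < 6)
    let h := i.+1 in let h' := j.+1 in
    if h' == h.+1 then (N h)%:R
    else if h == h'.+1 then 1
    else if (h == 6) && (h' == 1) then (N 6)%:R
    else if (h == 1) && (h' == 6) then 1
    else 0.

(* Main.v *)
Require Import Defs.
From mathcomp Require Import all_boot all_order all_algebra.
From mathcomp Require Import all_classical all_reals all_analysis.
From mathcomp Require Import complex ring lra.

(** Expanding the determinant, the characteristic polynomial of the matrix is a
    cubic f evaluated at the square of the variable. If Delta < 0, then f has
    three real roots, which are positive because f < 0 on ]-oo, 0]. So every
    complex eigenvalue is plus or minus the square root of a root of f, and the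
    largest eigenvalue in modulus comes from the largest root. *)

Import Order.TTheory GRing.Theory Num.Theory.
Local Open Scope ring_scope.

(** Cofactor expansion along the first row, on entry functions rather than matrices: for a concrete
    size it reduces to a formula that [ring] can handle. *)
Fixpoint laplace (K : comNzRingType) (n : nat) (F : nat -> nat -> K) : K :=
  if n is m.+1 then
    foldr (fun j s =>
             (-1) ^+ j
             * (F 0%N j * laplace K m (fun i k : nat => F i.+1 (bump j k))) + s)
      0 (iota 0 m.+1)
  else 1.

Lemma det_laplace (K : comNzRingType) (n : nat) (F : nat -> nat -> K) :
  \det (\matrix_(i < n, j < n) F i j) = laplace K n F.
Proof.
elim: n F => [|n IHn] F; first by rewrite det_mx00.
rewrite (expand_det_row _ ord0).
transitivity (\sum_(0 <= j < n.+1)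
  (-1) ^+ j * (F 0%N j * laplace K n (fun i k : nat => F i.+1 (bump j k)))).
  rewrite big_mkord; apply: eq_bigr => j _; rewrite mxE /cofactor mulrCA -IHn.
  congr (_ * (_ * \det _)); apply/matrixP => i k; by rewrite !mxE.
by rewrite unlock /reducebig /index_iota subn0.
Qed.

(** Sets of k disjoint 2-cycles of the digraph contribute products of k pairwise non-adjacent
    weights with sign [(-1)^k]; the two 6-cycles contribute the last two terms. *)
Lemma det_cyclic6 (K : comNzRingType) (x : K) (w : nat -> K) :
  \det (\matrix_(i < 6, j < 6)
    let h := i.+1 in let h' := j.+1 in
    (if h == h' then x else 0) -
    (if h' == h.+1 then w h
    else if h == h'.+1 then 1
    else if (h == 6) && (h' == 1) then w 6
    else if (h == 1) && (h' == 6) then 1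
    else 0)) =
  x ^+ 6 - (w 1 + w 2 + w 3 + w 4 + w 5 + w 6) * x ^+ 4
  + (w 1 * w 3 + w 1 * w 4 + w 1 * w 5 + w 2 * w 4 + w 2 * w 5 + w 2 * w 6
   + w 3 * w 5 + w 3 * w 6 + w 4 * w 6) * x ^+ 2
  - (w 1 * w 3 * w 5 + w 2 * w 4 * w 6) - w 1 * w 2 * w 3 * w 4 * w 5 * w 6 - 1.
Proof.
pose G := fun i j : nat => (if i.+1 == j.+1 then x else 0) -
    (if j.+1 == i.+2 then w i.+1
    else if i.+1 == j.+2 then 1
    else if (i.+1 == 6) && (j.+1 == 1) then w 6
    else if (i.+1 == 1) && (j.+1 == 6) then 1
    else 0).
rewrite (det_laplace K 6 G) /laplace /iota /foldr /bump /= /G /= !subr0 !sub0r.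
ring.
Qed.

Definition char_cubic (K : nzRingType) (N : nat -> nat) (mu : K) : K :=
  mu ^+ 3 - (Sigma N)%:R * mu ^+ 2 + (Gamma1 N)%:R * mu
  - (Gamma0 N)%:R - (Pi N)%:R - 1.

(* Stated over any field containing R, to serve both for the real eigenvalue
   and for the complex spectrum entering the spectral radius. *)
Lemma eigenvalue_cyc_mx (R : realType) (K : fieldType) (f : {rmorphism R -> K})
    (N : nat -> nat) (z : K) :
  eigenvalue (map_mx f (cyc_mx R N)) z = (char_cubic K N (z ^+ 2) == 0).
Proof.
rewrite eigenvalue_root_char /char_poly.
have -> : char_poly_mx (map_mx f (cyc_mx R N)) = \matrix_(i < 6, j < 6)
    let h := i.+1 in let h' := j.+1 in
    (if h == h' then 'X else 0) -
    (if h' == h.+1 then (N h)%:R%:P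
    else if h == h'.+1 then 1
    else if (h == 6) && (h' == 1) then (N 6)%:R%:P
    else if (h == 1) && (h' == 6) then 1
    else 0).
  apply/matrixP => i j; rewrite !mxE /=; congr (_ - _).
    by rewrite eqSS -val_eqE; case: (val i == val j).
  do 4![case: ifP => _; first by rewrite ?rmorph_nat ?rmorph1].
  by rewrite !rmorph0.
rewrite (det_cyclic6 _ _ (fun h => (N h)%:R%:P)) rootE !hornerE.
rewrite /char_cubic /Sigma /Pi unlock /= !natrD !natrM.
congr (_ == 0); ring.
Qed.

Lemma cos_triple (R : realType) (x : R) :
  cos (3 * x) = 4 * cos x ^+ 3 - 3 * cos x.
Proof.
have -> : 3 * x = x + (x + x) by ring.
have s2 := sin2cos2 x.
have -> : cos (x + (x + x)) = cos x ^+ 3 - 3 * cos x * sin x ^+ 2.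
  by rewrite !(cosD, sinD); ring.
by rewrite s2; ring.
Qed.

Lemma sin_triple (R : realType) (x : R) :
  sin (3 * x) = sin x * (3 * cos x ^+ 2 - sin x ^+ 2).
Proof.
have -> : 3 * x = x + (x + x) by ring.
by rewrite !(cosD, sinD); ring.
Qed.

(* Viete's trigonometric solution of the depressed cubic t^3 + p t + q = 0 with
   three real roots: with p = - 3 r^2, q = - 2 r^3 cos (3 th), c = cos th and
   s = sin th, they are 2 r c and - r (c +- sqrt 3 s); the first is the largest
   since 0 <= th <= pi / 3. *)
Lemma char_cubic_factor (R : realType) (N : nat -> nat) :
    Delta R N < 0 ->
  let mu0 := 1 / 3 * (Sigma N)%:R
             + 2 * Num.sqrt (- (1 / 3 * coef_p R N)) * cos (1 / 3 * Phi R N) in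
  exists mu1 mu2 : R, [/\ mu1 <= mu0, mu2 <= mu0 &
    forall (K : comNzRingType) (f : {rmorphism R -> K}) (mu : K),
      char_cubic K N mu = (mu - f mu0) * (mu - f mu1) * (mu - f mu2)].
Proof.
rewrite /Delta => Delta_lt0.
set p := coef_p R N in Delta_lt0 *; set q := coef_q R N in Delta_lt0 *.
(* Otherwise both terms of [Delta] would be non-negative. *)
have p_lt0 : p < 0.
  by rewrite ltNge; apply/negP => p_ge0; have := exprn_ge0 3 p_ge0; nra.
set r := Num.sqrt _.
have r2 : r ^+ 2 = - (1 / 3 * p) by rewrite sqr_sqrtr //; lra.
have r_gt0 : 0 < r by rewrite sqrtr_gt0; lra.
clearbody r.
have pE : p = - 3 * r ^+ 2 by lra.
have argE : 3 * q / (2 * p) * Num.sqrt (- (3 / p)) = - q / (2 * r ^+ 3).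
  have -> : - (3 / p) = r^-1 ^+ 2 by rewrite pE; field; rewrite gt_eqF.
  by rewrite sqrtr_sqr ger0_norm ?invr_ge0 ?ltW // pE; field; rewrite gt_eqF.
have r3_gt0 : 0 < 2 * r ^+ 3 by rewrite mulr_gt0 ?exprn_gt0.
(* [Delta] equals [q^2 - 4 r^6], so its negativity puts the argument in the range where [acos]
   inverts [cos]. *)
have arg_bd : -1 <= - q / (2 * r ^+ 3) <= 1.
  have : `|q| <= 2 * r ^+ 3.
    rewrite -ler_sqr ?nnegrE ?normr_ge0 ?(ltW r3_gt0) // real_normK ?num_real //.
    by move: Delta_lt0; rewrite pE; lra.
  by rewrite ler_norml => /andP[? ?]; rewrite ler_pdivlMr // ler_pdivrMr //; lra.
rewrite /Phi -/p -/q argE; have [] := acos_def arg_bd.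
set phi := acos _ => /andP[phi_ge0 phi_lepi] cos_phi.
set th := 1 / 3 * phi.
have thE : 3 * th = phi by rewrite /th; field.
have pi_gt0 := pi_gt0 R.
have cos_ge0 : 0 <= cos th by apply: cos_ge0_pihalf; rewrite /th; lra.
have sin_ge0 : 0 <= sin th by apply: sin_ge0_pi; rewrite /th; lra.
(* From [3 * th] in [[0, pi]]; this encodes [th <= pi / 3] algebraically and yields [s <= w * c]
   below. *)
have sin3_ge0 : 0 <= sin th * (3 * cos th ^+ 2 - sin th ^+ 2).
  by rewrite -sin_triple thE sin_ge0_pi ?phi_ge0.
have s2c2 := cos2Dsin2 th.
have w3 : Num.sqrt 3 ^+ 2 = 3 :> R by rewrite sqr_sqrtr.
have w3_ge0 : 0 <= Num.sqrt 3 :> R by rewrite sqrtr_ge0.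
have qE : q = - 2 * r ^+ 3 * (4 * cos th ^+ 3 - 3 * cos th).
  by rewrite -cos_triple thE cos_phi; field; rewrite gt_eqF.
set c := cos th in cos_ge0 sin3_ge0 s2c2 qE *.
set s := sin th in sin_ge0 sin3_ge0 s2c2 *.
set w := Num.sqrt 3 in w3 w3_ge0.
have s_le : s <= w * c.
  rewrite -ler_sqr ?nnegrE ?mulr_ge0 // exprMn w3.
  move: sin_ge0; rewrite le_eqVlt => /orP[/eqP <-|s_gt0]; first by nra.
  by move: sin3_ge0; rewrite pmulr_rge0 //; lra.
set mu0 := _ + _.
(* The terms after the shift by a third of [Sigma] are [2 r cos (th + 2 pi / 3)] and
   [2 r cos (th - 2 pi / 3)], expanded. *)
pose mu1 := 1 / 3 * (Sigma N)%:R - r * (c + w * s).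
pose mu2 := 1 / 3 * (Sigma N)%:R - r * (c - w * s).
exists mu1, mu2; split.
- have -> : mu0 = mu1 + r * (3 * c + w * s) by rewrite /mu0 /mu1; ring.
  by rewrite lerDl mulr_ge0 ?addr_ge0 ?mulr_ge0 // ltW.
- have -> : mu0 = mu2 + r * (w * (w * c - s)) by rewrite /mu0 /mu2; ring: w3.
  by rewrite lerDl !mulr_ge0 ?subr_ge0 // ltW.
have s2E : s ^+ 2 = 1 - c ^+ 2 by rewrite -s2c2; ring.
(* Vieta's relations, checked in [R], where division by 3 is available. *)
have e1 : (Sigma N)%:R = mu0 + mu1 + mu2 by rewrite /mu0 /mu1 /mu2; field.
have e2 : (Gamma1 N)%:R = mu0 * mu1 + mu0 * mu2 + mu1 * mu2.
  have -> : (Gamma1 N)%:R = p + 1 / 3 * (Sigma N)%:R ^+ 2.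
    by rewrite /p /coef_p; field.
  by rewrite pE /mu0 /mu1 /mu2; field: s2E w3.
have e3 : (Gamma0 N)%:R + (Pi N)%:R + 1 = mu0 * mu1 * mu2.
  have -> : (Gamma0 N)%:R + (Pi N)%:R + 1 =
      - q + 1 / 3 * (Sigma N)%:R * p + 1 / 27 * (Sigma N)%:R ^+ 3.
    by rewrite /p /q /coef_p /coef_q; field.
  by rewrite qE pE /mu0 /mu1 /mu2; field: s2E w3.
move=> K f mu.
clearbody mu0 mu1 mu2.
(* The coefficients are natural numbers, so [f] carries the relations to [K]. *)
have f1 : (Sigma N)%:R = f mu0 + f mu1 + f mu2.
  by rewrite -(rmorph_nat f) e1 !rmorphD.
have f2 : (Gamma1 N)%:R = f mu0 * f mu1 + f mu0 * f mu2 + f mu1 * f mu2.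
  by rewrite -(rmorph_nat f) e2 !(rmorphD, rmorphM).
have f3 : (Gamma0 N)%:R + (Pi N)%:R + 1 = f mu0 * f mu1 * f mu2.
  by rewrite -!(rmorphM f) -e3 !(rmorphD f) (rmorph1 f) !(rmorph_nat f).
transitivity (mu ^+ 3 - (Sigma N)%:R * mu ^+ 2 + (Gamma1 N)%:R * mu
  - ((Gamma0 N)%:R + (Pi N)%:R + 1)); first by rewrite /char_cubic; ring.
by rewrite f1 f2 f3; ring.
Qed.

(** Consecutive indices are joined by arcs in both directions, so any two indices are connected
    through 0. *)
Lemma irreducible_cyc_mx (R : realType) (N : nat -> nat) :
  (forall h : nat, (1 <= h <= 6)%N -> (0 < N h)%N) ->
  irreducible_mx (cyc_mx R N).
Proof.
move=> N_gt0 i j.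
set e := fun k l => cyc_mx R N k l != 0.
have N_neq0 h : (1 <= h <= 6)%N -> (N h)%:R != 0 :> R.
  by move=> hh; rewrite pnatr_eq0 -lt0n N_gt0.
have e_next (k : 'I_6) (k_lt : (k.+1 < 6)%N) :
    e k (Ordinal k_lt) && e (Ordinal k_lt) k.
  case: k k_lt => [[|[|[|[|[|k]]]]] ?] ? //;
    by rewrite /e !mxE /= N_neq0 // oner_eq0.
have from0 (k : nat) (k_lt : (k < 6)%N) :
    connect e ord0 (Ordinal k_lt) && connect e (Ordinal k_lt) ord0.
  elim: k k_lt => [|k IHk] k_lt.
    by rewrite (_ : Ordinal _ = ord0) ?connect0 //; exact: val_inj.
  have /andP[to_k of_k] := IHk (ltnW k_lt).
  have /andP[e1 e2] := e_next (Ordinal (ltnW k_lt)) k_lt.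
  rewrite (connect_trans to_k (connect1 e1)).
  by rewrite (connect_trans (connect1 e2) of_k).
have /andP[_ i0] := from0 _ (ltn_ord i).
have /andP[j0 _] := from0 _ (ltn_ord j).
move: (connect_trans i0 j0); congr (connect e _ _); exact: val_inj.
Qed.

(** At [mu <= 0] every term is non-positive and the constant -1 makes the sum negative. *)
Lemma char_cubic_root_gt0 (R : realType) (N : nat -> nat) (mu : R) :
  char_cubic R N mu = 0 -> 0 < mu.
Proof.
move=> mu_root; rewrite ltNge; apply/negP => mu_le0.
suff : char_cubic R N mu < 0 by rewrite mu_root ltxx.
rewrite /char_cubic.
have h3 : mu ^+ 3 <= 0 by rewrite exprn_odd_le0.
have h2 : 0 <= (Sigma N)%:R * mu ^+ 2 by rewrite mulr_ge0 ?sqr_ge0.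
have h1 : (Gamma1 N)%:R * mu <= 0 by rewrite mulr_ge0_le0.
have h0 : 0 <= (Gamma0 N)%:R :> R by [].
have hP : 0 <= (Pi N)%:R :> R by [].
lra.
Qed.

Theorem mainTheorem8 (R : realType) (N : nat -> nat)
  (N_gt0 : forall h : nat, (1 <= h <= 6)%N -> (0 < N h)%N)
  (Pi_gt1 : (1 < Pi N)%N)
  (Delta_lt0 : Delta R N < 0) :
  is_perron_eigenvalue (cyc_mx R N)
    (Num.sqrt (1 / 3 * (Sigma N)%:R
               + 2 * Num.sqrt (- (1 / 3 * coef_p R N))
                 * cos (1 / 3 * Phi R N))).
Proof.
have [mu1 [mu2 []]] := @char_cubic_factor R N Delta_lt0.
set mu0 := _ + _ => mu1_le mu2_le factor.
have factorR := factor R idfun.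
have mu0_gt0 : 0 < mu0
  by apply: (@char_cubic_root_gt0 R N); rewrite factorR subrr !mul0r.
have mu1_gt0 : 0 < mu1
  by apply: (@char_cubic_root_gt0 R N); rewrite factorR subrr mulr0 mul0r.
have mu2_gt0 : 0 < mu2
  by apply: (@char_cubic_root_gt0 R N); rewrite factorR subrr mulr0.
(* Used with the embedding into [R[i]] for the spectral radius and with the identity for the real
   eigenvalue. *)
have eig (K : fieldType) (f : {rmorphism R -> K}) :
    eigenvalue (map_mx f (cyc_mx R N)) (f (Num.sqrt mu0)).
  by rewrite eigenvalue_cyc_mx (factor K f) -rmorphXn sqr_sqrtr ?ltW //=
    subrr !mul0r eqxx.
have normc_eig z : eigenvalue (map_mx (real_complex R) (cyc_mx R N)) z ->
    ComplexField.Normc.normc z <= Num.sqrt mu0.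
  rewrite eigenvalue_cyc_mx (factor _ (real_complex R)) !mulf_eq0 !subr_eq0.
  (* The squared modulus of [z] is the modulus of [z ^+ 2], which is [mu]. *)
  have bound mu : 0 < mu -> mu <= mu0 -> z ^+ 2 = real_complex R mu ->
      ComplexField.Normc.normc z <= Num.sqrt mu0.
    move=> mu_gt0 mu_le z2.
    have norm_ge0 : 0 <= ComplexField.Normc.normc z.
      by case: (z) => a b; exact: sqrtr_ge0.
    rewrite -[leLHS]ger0_norm // -sqrtr_sqr ler_sqrt ?(ltW mu0_gt0) //.
    rewrite expr2 -ComplexField.Normc.normcM -expr2 z2 /= expr0n addr0 sqrtr_sqr.
    by rewrite gtr0_norm.
  by case/orP => [/orP[]|] /eqP; apply: bound.
split.
- move=> i j; rewrite mxE /=.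
  by repeat case: ifP => _.
- exact: irreducible_cyc_mx.
(* The value is both a member and an upper bound of the set of moduli, hence its supremum. *)
- apply/eqP; rewrite eq_le; apply/andP; split.
    apply: ub_le_sup.
      by exists (Num.sqrt mu0) => _ [z /= zE <-]; exact: normc_eig.
    exists (real_complex R (Num.sqrt mu0)); first exact: eig.
    by rewrite /= expr0n addr0 sqrtr_sqr ger0_norm ?sqrtr_ge0.
  apply: ge_sup.
    by eexists; exists (real_complex R (Num.sqrt mu0)); first exact: eig.
  by move=> _ [z /= zE <-]; exact: normc_eig.
- by have := eig R idfun; rewrite map_mx_id.
Qed.
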